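(* Suppose that $\mathcal{K}\subseteq\mathcal{E}$ is a full-dimensional closed convex pointed amenable cone and $\mathcal{V}$ is an affine space such that $\mathcal{K}\cap\mathcal{V}\neq\emptyset$. Let $\mathcal{F}_\ell\subsetneq\cdots\subsetneq\mathcal{F}_1=\mathcal{K}$ be a chain of faces of $\mathcal{K}$ together with $z_i\in\mathcal{F}_i^*\cap\mathcal{V}^\perp$ such that $\mathcal{F}_{i+1}=\mathcal{F}_i\cap\{z_i\}^\perp$ for $1\le i<\ell$, and assume that $\mathcal{F}_\ell,\mathcal{V}$ satisfy the PPS condition. For $i=1,\ldots,\ell-1$, let $\psi_i$ be a (suitably positively rescaled) facial residual function for $\mathcal{F}_i,z_i$, let $\varphi=\psi_{\ell-1}\diamondsuit\cdots\diamondsuit\psi_1$ if $\ell\ge2$ and $\varphi(\epsilon,t)=\epsilon$ if $\ell=1$, and let $\kappa>0$ be such that the following amenable cone error bound holds: whenever $x\in\mathrm{span}\,\mathcal{K}$ satisfies $\mathrm{dist}(x,\mathcal{K})\le\epsilon$ and $\mathrm{dist}(x,\mathcal{V})\le\epsilon$, one has $$\mathrm{dist}(x,\mathcal{K}\cap\mathcal{V})\le(\kappa\|x\|+\kappa)\big(\epsilon+\varphi(\epsilon,\|x\|)\big).$$ If $\varphi(\cdot,b)$ is right-continuous at $0$ for every $b\ge0$, then $$\Phi(a,b):=(\kappa b+\kappa)\big(a+\varphi(a,b)\big)$$ is a strict consistent error bound function for $\mathcal{K}$ and $\mathcal{V}$.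
   Context: $\mathcal{E}$ is a finite-dimensional real vector space with norm $\|\cdot\|$ induced by an inner product $\langle\cdot,\cdot\rangle$, and $\mathrm{dist}(x,D)=\min_{y\in D}\|x-y\|$. $\mathrm{ri}$, $D^\perp$, $\mathrm{span}$, $D^*$ denote relative interior, orthogonal complement, linear span and dual cone. $\mathcal{K}$ is amenable if for every face $\mathcal{F}$ of $\mathcal{K}$ there is a constant $\kappa$ with $\mathrm{dist}(x,\mathcal{F})\le\kappa\,\mathrm{dist}(x,\mathcal{K})$ for every $x\in\mathrm{span}\,\mathcal{F}$. PPS condition for $\mathcal{F},\mathcal{V}$: $\mathcal{F}$ can be written as a direct product $P\times\tilde{\mathcal{F}}$, with $P$ a (possibly trivial) polyhedral cone and $\tilde{\mathcal{F}}$ an arbitrary cone, such that $(P\times\mathrm{ri}\,\tilde{\mathcal{F}})\cap\mathcal{V}\neq\emptyset$. Facial residual function: for a face $\mathcal{F}$ of $\mathcal{K}$ and $z\in\mathcal{F}^*$, a function $\psi_{\mathcal{F},z}:[0,\infty)\times[0,\infty)\to[0,\infty)$ such that (i) it is nonnegative, monotone nondecreasing in each argument and $\psi_{\mathcal{F},z}(0,\alpha)=0$ for all $\alpha\ge0$; (ii) whenever $x\in\mathrm{span}\,\mathcal{K}$ satisfies $\mathrm{dist}(x,\mathcal{K})\le\epsilon$, $\langle x,z\rangle\le\epsilon$, $\mathrm{dist}(x,\mathrm{span}\,\mathcal{F})\le\epsilon$, then $\mathrm{dist}(x,\mathcal{F}\cap\{z\}^\perp)\le\psi_{\mathcal{F},z}(\epsilon,\|x\|)$.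 A positive rescaling of $\psi$ is a function $M_3\psi(M_1\epsilon,M_2t)$ with $M_1,M_2,M_3>0$. Diamond composition: $(\psi_2\diamondsuit\psi_1)(a,b)=\psi_2(a+\psi_1(a,b),b)$. (It is a known theorem that, for any facial residual functions, some positive rescaling and some $\kappa>0$ make the amenable cone error bound in the claim valid.) A strict consistent error bound function for closed convex sets $C_1,\ldots,C_m$ with $C:=\bigcap_iC_i\neq\emptyset$ is a function $\Phi:[0,\infty)\times[0,\infty)\to[0,\infty)$ such that: (i) $\mathrm{dist}(x,C)\le\Phi\big(\max_{1\le i\le m}\mathrm{dist}(x,C_i),\|x\|\big)$ for all $x\in\mathcal{E}$; (ii) for every fixed $b\ge 0$, $\Phi(\cdot,b)$ is monotone nondecreasing on $[0,\infty)$, right-continuous at $0$, and $\Phi(0,b)=0$; (iii) for every fixed $a\ge0$, $\Phi(a,\cdot)$ is monotone nondecreasing; and (strictness) for every $b>0$, $\Phi(\cdot,b)$ is strictly increasing on $[0,\infty)$. *)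

(* Defs.v *)
From HB Require Import structures.
From mathcomp Require Import all_boot all_order all_algebra.
From mathcomp Require Import all_classical all_reals all_analysis.

Set Implicit Arguments.
Unset Strict Implicit.
Unset Printing Implicit Defensive.

Import Order.TTheory GRing.Theory Num.Theory.
Import numFieldNormedType.Exports.

Local Open Scope classical_set_scope.
Local Open Scope ring_scope.

(* A finite-dimensional (Vector) real space whose norm, and hence whose
   topology, is the one induced by an inner product. *)
HB.mixin Record isEuclidean (R : realType) E of
    NormedModule R E & Vector R E := {
  inner : {dot E for (@idfun R)} ;
  norm_inner : forall x : E, `|x| = Num.sqrt (inner x x)
}.

#[short(type="euclideanType")]
HB.structure Definition Euclidean (R : realType) :=
  {E of isEuclidean R E & NormedModule R E & Vector R E}.

Section ConicGeometry.
Context {R : realType} {E : euclideanType R}.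
Implicit Types (x y z : E) (C D F G K P V : set E) (a b : R).

(* Only meaningful for D nonempty; the infimum is a minimum when D is closed. *)
Definition dist x D : R := inf [set `|x - y| | y in D].

Definition lin_span D : set E :=
  [set x | forall L : {vspace E}, D `<=` [set` L] -> x \in L].

Definition affine_space V : Prop :=
  exists (x0 : E) (L : {vspace E}), V = [set x | x - x0 \in L].

Definition aff_hull D : set E :=
  [set x | forall V, affine_space V -> D `<=` V -> V x].

Definition rel_interior D : set E :=
  [set x | D x /\ exists2 r : R, 0 < r & ball x r `&` aff_hull D `<=` D].

Definition orth_compl D : set E := [set z | forall x, D x -> inner x z = 0].

Definition dual_cone D : set E := [set z | forall x, D x -> 0 <= inner x z].

Definition convex_cone C : Prop :=
  [/\ C !=set0, convex_set C & forall (t : R) x, 0 <= t -> C x -> C (t *: x)].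

Definition pointed C : Prop := forall x, C x -> C (- x) -> x = 0.

Definition full_dimensional C : Prop := aff_hull C = setT.

Definition polyhedral_cone P : Prop :=
  exists s : seq E, P = [set x | forall y, y \in s -> 0 <= inner y x].

Definition face K F : Prop :=
  [/\ convex_cone F, F `<=` K &
      forall x y, K x -> K y -> F (x + y) -> F x /\ F y].

Definition amenable K : Prop :=
  forall F, face K F ->
    exists kappa : R, forall x, lin_span F x -> dist x F <= kappa * dist x K.

(* The direct product is internal: the two factors live in independent
   subspaces, which are not required to be orthogonal. *)
Definition PPS F V : Prop :=
  exists (U W : {vspace E}) (P G : set E),
    [/\ (U :&: W = 0)%VS,
        P `<=` [set` U] /\ G `<=` [set` W],
        polyhedral_cone P /\ convex_cone G,
        F = [set p + g | p in P & g in G] &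
        [set p + g | p in P & g in rel_interior G] `&` V !=set0].

(* Functions [0, +oo[ x [0, +oo[ -> [0, +oo[ are represented by functions on
   R x R, of which only the values at nonnegative arguments are constrained. *)
Definition facial_residual_function K F z (psi : R -> R -> R) : Prop :=
  [/\ forall a b, 0 <= a -> 0 <= b -> 0 <= psi a b,
      forall a a' b, 0 <= a -> a <= a' -> 0 <= b -> psi a b <= psi a' b,
      forall a b b', 0 <= a -> 0 <= b -> b <= b' -> psi a b <= psi a b',
      forall b, 0 <= b -> psi 0 b = 0 &
      forall (eps : R) x, lin_span K x ->
        dist x K <= eps -> inner x z <= eps -> dist x (lin_span F) <= eps ->
        dist x (F `&` orth_compl [set z]) <= psi eps `|x|].

Definition positive_rescaling (psi psi' : R -> R -> R) : Prop :=
  exists M1 M2 M3 : R, [/\ 0 < M1, 0 < M2, 0 < M3 &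
    forall a b, 0 <= a -> 0 <= b -> psi' a b = M3 * psi (M1 * a) (M2 * b)].

Definition consistent_error_bound m (C : 'I_m -> set E) (Phi : R -> R -> R)
    : Prop :=
  [/\ forall a b, 0 <= a -> 0 <= b -> 0 <= Phi a b,
      forall x, dist x (\bigcap_i C i) <=
        Phi (\big[Num.max/0]_(i < m) dist x (C i)) `|x|,
      forall b, 0 <= b ->
        [/\ forall a a', 0 <= a -> a <= a' -> Phi a b <= Phi a' b,
            Phi ^~ b @ 0^'+ --> Phi 0 b &
            Phi 0 b = 0] &
      forall a, 0 <= a ->
        forall b b', 0 <= b -> b <= b' -> Phi a b <= Phi a b'].

Definition strict_consistent_error_bound m (C : 'I_m -> set E)
    (Phi : R -> R -> R) : Prop :=
  consistent_error_bound C Phi /\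
  (forall b, 0 < b -> forall a a', 0 <= a -> a < a' -> Phi a b < Phi a' b).

End ConicGeometry.

Section Diamond.
Context {R : realType}.

Definition diamond (psi2 psi1 : R -> R -> R) : R -> R -> R :=
  fun a b => psi2 (a + psi1 a b) b.

(* Diamond composition is not associative; the chain is nested to the right:
   psi_m <> (... <> (psi_2 <> psi_1)).  For m = 0 it is (a, b) |-> a. *)
Fixpoint diamond_chain (psi : nat -> R -> R -> R) (m : nat) : R -> R -> R :=
  match m with
  | 0 => fun a _ => a
  | 1 => psi 1%N
  | m'.+1 => diamond (psi m) (diamond_chain psi m')
  end.

End Diamond.

(* Main.v *)
Require Import Defs.
From HB Require Import structures.
From mathcomp Require Import all_boot all_order all_algebra.
From mathcomp Require Import all_classical all_reals all_analysis.

(** The error bound hypothesis already has the shape of the estimate asked of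
    Phi, so the work lies in the regularity of Phi.

    The estimate is applied with eps the larger of the two distances. Its
    domain lin_span K is the whole space because K is full-dimensional: every
    linear subspace containing K is in particular an affine space containing K
    (lemma lin_span_full_dimensional).

    Nonnegativity, monotonicity in each argument and vanishing at a = 0 hold
    for facial residual functions by definition, and they survive positive
    rescaling and diamond composition; hence phi has them
    (lemma diamond_chain_residual_modulus). Multiplication by kappa b + kappa,
    which is positive and nondecreasing in b, preserves them, as it does right
    continuity at 0. Strictness does not come from phi, which may well be
    constant in a: it comes from the summand a of a + phi(a, b). *)

Set Implicit Arguments.
Unset Strict Implicit.
Unset Printing Implicit Defensive.

Import Order.TTheory GRing.Theory Num.Theory.
Import numFieldNormedType.Exports.

Local Open Scope classical_set_scope.
Local Open Scope ring_scope.

Section ResidualModulus.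
Context {R : realType}.
Implicit Types psi : R -> R -> R.

(** The part of the definition of a facial residual function that mentions
    neither the cone nor the face, which is the part that passes to diamond
    compositions. *)
Definition residual_modulus psi : Prop :=
  [/\ forall a b, 0 <= a -> 0 <= b -> 0 <= psi a b,
      forall a a' b, 0 <= a -> a <= a' -> 0 <= b -> psi a b <= psi a' b,
      forall a b b', 0 <= a -> 0 <= b -> b <= b' -> psi a b <= psi a b' &
      forall b, 0 <= b -> psi 0 b = 0].

Lemma residual_modulus_rescaling psi psi' :
  residual_modulus psi -> positive_rescaling psi psi' -> residual_modulus psi'.
Proof.
move=> [psi_ge0 psi_l psi_r psi0] [M1 [M2 [M3 [M1_gt0 M2_gt0 M3_gt0 psi'E]]]].
have M1_ge0 a : 0 <= a -> 0 <= M1 * a by move=> ?; rewrite mulr_ge0 // ltW.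
have M2_ge0 b : 0 <= b -> 0 <= M2 * b by move=> ?; rewrite mulr_ge0 // ltW.
split=> [a b a0 b0|a a' b a0 aa' b0|a b b' a0 b0 bb'|b b0].
- by rewrite psi'E // mulr_ge0 ?(ltW M3_gt0) // psi_ge0 ?M1_ge0 ?M2_ge0.
- have a'0 := le_trans a0 aa'.
  rewrite !psi'E // ler_pM2l // psi_l ?M1_ge0 ?M2_ge0 //.
  by rewrite ler_pM2l.
- have b'0 := le_trans b0 bb'.
  rewrite !psi'E // ler_pM2l // psi_r ?M1_ge0 ?M2_ge0 //.
  by rewrite ler_pM2l.
- by rewrite psi'E // mulr0 psi0 ?M2_ge0 // mulr0.
Qed.

Lemma residual_modulus_diamond psi2 psi1 :
  residual_modulus psi2 -> residual_modulus psi1 ->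
  residual_modulus (diamond psi2 psi1).
Proof.
move=> [p2_ge0 p2_l p2_r p20] [p1_ge0 p1_l p1_r p10]; rewrite /diamond.
have arg_ge0 a b : 0 <= a -> 0 <= b -> 0 <= a + psi1 a b.
  by move=> a0 b0; rewrite addr_ge0 // p1_ge0.
split=> [a b a0 b0|a a' b a0 aa' b0|a b b' a0 b0 bb'|b b0].
- by rewrite p2_ge0 // arg_ge0.
- by rewrite p2_l ?arg_ge0 // lerD // p1_l.
- have b'0 := le_trans b0 bb'.
  apply: (@le_trans _ _ (psi2 (a + psi1 a b') b)).
    by rewrite p2_l ?arg_ge0 // lerD2l p1_r.
  by rewrite p2_r ?arg_ge0.
- by rewrite p10 // addr0 p20.
Qed.

Lemma diamond_chain_residual_modulus (psi : nat -> R -> R -> R) m :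
  (forall i, (1 <= i <= m)%N -> residual_modulus (psi i)) ->
  residual_modulus (diamond_chain psi m).
Proof.
elim: m => [|[|m] IHm] psiP; first by split.
  exact: psiP.
apply: residual_modulus_diamond; first by apply: psiP; rewrite leqnn.
by apply: IHm => i /andP[i1 im]; apply: psiP; rewrite i1 (leq_trans im).
Qed.

End ResidualModulus.

Lemma lin_span_full_dimensional (R : realType) (E : euclideanType R)
  (K : set E) : full_dimensional K -> lin_span K = setT.
Proof.
move=> Kfull; apply/seteqP; split=> // x _ L KL.
have : aff_hull K x by rewrite Kfull.
move/(_ [set` L]); apply=> //; exists 0, L.
by apply/seteqP; split=> y /=; rewrite subr0.
Qed.

Theorem proposition6p3 (R : realType) (E : euclideanType R) (K V : set E)
    (K_cone : convex_cone K) (K_closed : closed K)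
    (K_pointed : pointed K) (K_full : full_dimensional K)
    (K_amenable : amenable K)
    (V_affine : affine_space V) (KV_nonempty : K `&` V !=set0)
    (ell : nat) (ell_gt0 : (0 < ell)%N)
    (F : nat -> set E) (z : nat -> E)
    (F_face : forall i, (1 <= i <= ell)%N -> face K (F i))
    (F_1 : F 1%N = K)
    (F_chain : forall i, (1 <= i < ell)%N -> F i.+1 `<` F i)
    (z_dual : forall i, (1 <= i < ell)%N ->
       (dual_cone (F i) `&` orth_compl V) (z i))
    (F_succ : forall i, (1 <= i < ell)%N ->
       F i.+1 = F i `&` orth_compl [set z i])
    (F_PPS : PPS (F ell) V)
    (psi : nat -> R -> R -> R)
    (psi_frf : forall i, (1 <= i < ell)%N ->
       exists2 psi0 : R -> R -> R,
         facial_residual_function K (F i) (z i) psi0 &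
         positive_rescaling psi0 (psi i))
    (phi : R -> R -> R)
    (phi_def : phi = diamond_chain psi ell.-1)
    (kappa : R) (kappa_gt0 : 0 < kappa)
    (error_bound : forall (eps : R) (x : E), lin_span K x ->
       dist x K <= eps -> dist x V <= eps ->
       dist x (K `&` V) <= (kappa * `|x| + kappa) * (eps + phi eps `|x|))
    (phi_rcont : forall b : R, 0 <= b -> phi ^~ b @ 0^'+ --> phi 0 b) :
  strict_consistent_error_bound
    (fun i : 'I_2 => if i == ord0 then K else V)
    (fun a b : R => (kappa * b + kappa) * (a + phi a b)).
Proof.
have [phi_ge0 phi_l phi_r phi0] : residual_modulus phi.
  rewrite phi_def; apply: diamond_chain_residual_modulus => i /andP[i1 il].
  have [|psi0 [p1 p2 p3 p4 _]] := psi_frf i.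
    by rewrite i1 -(prednK ell_gt0) ltnS.
  exact: residual_modulus_rescaling.
have coef_gt0 b : 0 <= b -> 0 < kappa * b + kappa.
  by move=> b0; rewrite ltr_wpDl // mulr_ge0 // ltW.
split; last first.
  move=> b /ltW b0 a a' a0 aa'; rewrite ltr_pM2l ?coef_gt0 //.
  by rewrite ltr_leD // phi_l // ltW.
split=> [a b a0 b0|x|b b0|a a0 b b' b0 bb'].
- by rewrite mulr_ge0 ?(ltW (coef_gt0 _ b0)) // addr_ge0 // phi_ge0.
- have -> : \bigcap_i (if i == ord0 :> 'I_2 then K else V) = K `&` V.
    apply/seteqP; split=> [y yKV|y [yK yV] i _]; last by case: ifP.
    by split; [exact: (yKV ord0)|exact: (yKV ord_max)].
  apply: error_bound; first by rewrite lin_span_full_dimensional.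
  + exact: (le_bigmax 0 (fun i : 'I_2 => dist x (if i == ord0 then K else V))
              ord0).
  + exact: (le_bigmax 0 (fun i : 'I_2 => dist x (if i == ord0 then K else V))
              ord_max).
- split=> [a a' a0 aa'||].
  + by rewrite ler_pM2l ?coef_gt0 // lerD // phi_l.
  + apply: cvgM; first exact: cvg_cst.
    apply: cvgD; last exact: phi_rcont.
    exact: cvg_within.
  + by rewrite phi0 // addr0 mulr0.
- have b'0 := le_trans b0 bb'.
  apply: ler_pM.
  + exact: ltW (coef_gt0 _ b0).
  + by rewrite addr_ge0 // phi_ge0.
  + by rewrite lerD2r ler_pM2l.
  + by rewrite lerD2l phi_r.
Qed.
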